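(* Let $(G,\lambda)$ be an always star temporal graph with lifetime $T$, and let $\Delta$ be an integer with $T\ge \Delta$ and $\Delta\ge 2$. The algorithm STAR-SC (described in the context) approximates the Sliding Window Temporal Vertex Cover problem with window size $\Delta$ on $(G,\lambda)$ with approximation ratio $2\Delta-1$, i.e. the size of the returned temporal vertex set is at most $(2\Delta-1)$ times the size of a minimum sliding $\Delta$-window temporal vertex cover, and it runs in $\mathcal{O}(T)$ time.
   Context: A temporal graph is a pair $(G,\lambda)$ where $G=(V,E)$ is a finite undirected graph (the underlying graph) with $n=|V|$, $m=|E|$, and $\lambda:E\to 2^{\mathbb{N}}$ assigns to each edge a set of discrete time labels, all lying in $\{1,\dots,T\}$, where $T$ is the lifetime. An edge $e$ is active at time $t$ if $t\in\lambda(e)$. The snapshot $G_t$ is the subgraph of active edges at time $t$. The temporal graph is an always star temporal graph if every snapshot $G_t$, $t\in\{1,\dots,T\}$, is a star (the center may differ between time steps). A vertex appearance is a pair $(u,t)$ with $u\in V$, $1\le t\le T$; it temporally covers an edge $e$ if $u$ is an endpoint of $e$ and $t\in\lambda(e)$. For a window size $\Delta$, the time window $W_t=\{t,t+1,\dots,t+\Delta-1\}$ for each $t\in\{1,\dots,T-\Delta+1\}$, and $E[W_t]=\{e\in E:\lambda(e)\cap W_t\ne\emptyset\}$. Sliding Window Temporal Vertex Cover ($\Delta$-TVC): find a set $S$ of vertex appearances of minimum cardinality such that for every window $W_t$ and every $e\in E[W_t]$, $e$ is temporally covered by some $(w,t')\in S$ with $t'\in W_t$. The temporal graph is stored so that the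 edges active at any given time step, and the edges incident to any vertex, can be accessed in $\mathcal{O}(1)$ time. Algorithm STAR-SC: for every time step $t$ at which at least one edge is active, add $(c_t,t)$ to the output, where $c_t$ is the star center of $G_t$; if at least two edges are active, $c_t$ is the common endpoint of two arbitrary active edges, and if exactly one edge $e=(v,w)$ is active, $c_t=v$. An approximation ratio $\rho$ means that on every input the output size is at most $\rho$ times the optimum size. *)

(* Defs.v *)
From mathcomp Require Import all_boot finmap.

Set Implicit Arguments.
Unset Strict Implicit.
Unset Printing Implicit Defensive.

Local Open Scope nat_scope.
Local Open Scope fset_scope.

(* Only the values of [label] on [edges] are meaningful. *)
Record temporalGraph (V : finType) := TemporalGraph {
  edges : {set {set V}};
  edges_card2 : forall e, e \in edges -> #|e| = 2;
  lifetime : nat;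
  label : {set V} -> {pred nat};
  label_bound : forall e t,
    e \in edges -> t \in label e -> 1 <= t <= lifetime
}.

Section TemporalVertexCover.
Variables (V : finType) (G : temporalGraph V).

Definition snapshot (t : nat) : {set {set V}} :=
  [set e in edges G | t \in label G e].

(* Vertices that are isolated at time t are ignored, and a snapshot without
   active edges counts as a (degenerate) star. *)
Definition is_star (F : {set {set V}}) : bool :=
  (F == set0) || [exists c, [forall e in F, c \in e]].

Definition always_star : Prop :=
  forall t, 1 <= t <= lifetime G -> is_star (snapshot t).

Definition is_appearance (a : V * nat) : bool := 1 <= a.2 <= lifetime G.

Definition temporally_covers (a : V * nat) (e : {set V}) : bool :=
  (a.1 \in e) && (a.2 \in label G e).

Definition window (Delta t : nat) : seq nat := iota t Delta.

Definition window_edges (Delta t : nat) : {set {set V}} :=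
  [set e in edges G | has (mem (label G e)) (window Delta t)].

Definition sliding_tvc (Delta : nat) (S : {fset V * nat}) : Prop :=
  (forall a, a \in S -> is_appearance a) /\
  forall t, 1 <= t <= lifetime G - Delta + 1 ->
  forall e, e \in window_edges Delta t ->
  exists a, [/\ a \in S, a.2 \in window Delta t & temporally_covers a e].

Definition minimum_sliding_tvc (Delta : nat) (S : {fset V * nat}) : Prop :=
  sliding_tvc Delta S /\
  forall S', sliding_tvc Delta S' -> #|` S| <= #|` S'|.

Definition edge_of (p : V * V) : {set V} := [set p.1; p.2]%SET.

(* The order of the lists and the orientation of the stored edges are
   unconstrained, so the first entries of a list are arbitrary edges. *)
Record storage := Storage {
  active_list : nat -> seq (V * V);
  active_listP : forall t, 1 <= t <= lifetime G ->
    perm_eq [seq edge_of p | p <- active_list t] (enum (snapshot t));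
  incident_list : V -> seq (V * V);
  incident_listP : forall v,
    perm_eq [seq edge_of p | p <- incident_list v]
            (enum [set e in edges G | v \in e])
}.

End TemporalVertexCover.

(* A unit-cost machine with registers for numbers, for vertices and for (pointers to)
   linked lists of edges, and a write-only output.  Its syntax does not mention
   the input, so a program has constant size.  Each instruction, including the
   evaluation of a guard, takes one step; the two retrievals [Active] and
   [Incident] return a pointer to a stored list. *)

Inductive test :=
  | Leq of nat & nat              (* number registers *)
  | IsNil of nat                  (* list register *)
  | SameVertex of nat & nat.      (* vertex registers *)

(* The destination register is always the first argument. *)
Inductive instr :=
  | Zero of nat
  | Incr of nat
  | Lifetime of nat
  | Active of nat & nat           (* list := edges active at time (number) *)
  | Incident of nat & nat         (* list := edges incident to (vertex) *)
  | Next of nat & nat             (* list := tail of (list) *)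
  | HeadFst of nat & nat          (* vertex := 1st endpoint of head of (list) *)
  | HeadSnd of nat & nat          (* vertex := 2nd endpoint of head of (list) *)
  | Emit of nat & nat             (* output the pair (vertex, number) *)
  | If of test & seq instr & seq instr
  | While of test & seq instr.

Section Machine.
Variables (V : finType) (G : temporalGraph V) (st : storage G).

Record state := State {
  num : nat -> nat;
  vtx : nat -> option V;
  lst : nat -> seq (V * V);
  out : seq (V * nat)
}.

Definition init_state : state :=
  State (fun=> 0) (fun=> None) (fun=> [::]) [::].

Definition set_num (s : state) (x n : nat) : state :=
  State [eta num s with x |-> n] (vtx s) (lst s) (out s).
Definition set_vtx (s : state) (x : nat) (v : option V) : state :=
  State (num s) [eta vtx s with x |-> v] (lst s) (out s).
Definition set_lst (s : state) (x : nat) (l : seq (V * V)) : state :=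
  State (num s) (vtx s) [eta lst s with x |-> l] (out s).
Definition emit (s : state) (a : V * nat) : state :=
  State (num s) (vtx s) (lst s) (a :: out s).

Definition eval (b : test) (s : state) : bool :=
  match b with
  | Leq x y => num s x <= num s y
  | IsNil l => nilp (lst s l)
  | SameVertex u v => vtx s u == vtx s v
  end.

(* A configuration is the list of instructions still to be executed together
   with the current state; it is final, and then fixed by [step], when the list
   is empty. *)
Definition step (cfg : seq instr * state) : seq instr * state :=
  let: (p, s) := cfg in
  if p is i :: k then
    match i with
    | Zero x => (k, set_num s x 0)
    | Incr x => (k, set_num s x (num s x).+1)
    | Lifetime x => (k, set_num s x (lifetime G))
    | Active l x => (k, set_lst s l (active_list st (num s x)))
    | Incident l u =>
        (k, set_lst s l (if vtx s u is Some v then incident_list st v else [::]))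
    | Next l l' => (k, set_lst s l (behead (lst s l')))
    | HeadFst u l => (k, set_vtx s u (omap fst (ohead (lst s l))))
    | HeadSnd u l => (k, set_vtx s u (omap snd (ohead (lst s l))))
    | Emit u x => (k, if vtx s u is Some v then emit s (v, num s x) else s)
    | If b p1 p2 => ((if eval b s then p1 else p2) ++ k, s)
    | While b q => (if eval b s then q ++ p else k, s)
    end
  else cfg.

(* Program p halts on the stored input after at most n steps, having output
   the set S. *)
Definition outputs_in (p : seq instr) (n : nat) (S : {fset V * nat}) : Prop :=
  exists s, iter n step (p, init_state) = ([::], s) /\
            S = [fset a in out s].

End Machine.

Section StarSC.
(* Register numbers: t, T are number registers, L is a list register, and
   v, w, v', w' are vertex registers. *)
Let t := 0.
Let T := 1.
Let L := 0.
Let v := 0.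
Let w := 1.
Let v' := 2.
Let w' := 3.

Definition star_sc : seq instr := [::
  Lifetime T;
  Zero t; Incr t;
  While (Leq t T) [::
    Active L t;
    If (IsNil L) [::] [::
      HeadFst v L; HeadSnd w L;
      Next L L;
      If (IsNil L)
        [:: Emit v t]
        [:: HeadFst v' L; HeadSnd w' L;
            If (SameVertex v v') [:: Emit v t] [::
            If (SameVertex v w') [:: Emit v t]
                                 [:: Emit w t]]]];
    Incr t]].

End StarSC.

(* Main.v *)
Require Import Defs.
From mathcomp Require Import all_boot finmap zify.

(** A minimum cover must, in any window containing a time t at which some edge
    is active, contain an appearance in that window, hence at distance less than
    Delta from t.  So every appearance of the cover accounts for at most
    2 * Delta - 1 active times, while STAR-SC outputs one appearance per active
    time. *)

Local Open Scope nat_scope.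
Local Open Scope fset_scope.

(** Mirrors the branches of [star_sc]: [p.2] is returned without a further test, which is sound only
    when the edges form a star. *)
Definition star_center {V : eqType} (l : seq (V * V)) : option V :=
  match l with
  | [::] => None
  | [:: p] => Some p.1
  | p :: q :: _ => Some (if (p.1 == q.1) || (p.1 == q.2) then p.1 else p.2)
  end.

Definition star_appearance {V : finType} {G : temporalGraph V} (st : storage G)
    (t : nat) : option (V * nat) :=
  omap (pair^~ t) (star_center (active_list st t)).

(** Times are listed in decreasing order because the machine conses each emitted pair onto [out]. *)
Definition star_output {V : finType} {G : temporalGraph V} (st : storage G)
    (n : nat) : seq (V * nat) :=
  pmap (star_appearance st) (rev (iota 1 n)).

Section Execution.
Variables (V : finType) (G : temporalGraph V) (st : storage G).

Let loop := drop 3 star_sc.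

(** Symbolic execution along each branch, every guard counted as a step. The longest path, with two
    failed or one failed and one successful [SameVertex] test, takes 13 steps. *)
Lemma star_sc_iteration (s : state V) :
  num s 0 <= num s 1 ->
  exists2 k, k <= 13 & exists s' : state V,
    [/\ iter k (step st) (loop, s) = (loop, s'),
        num s' 0 = (num s 0).+1, num s' 1 = num s 1
      & out s' = oapp (cons^~ (out s)) (out s) (star_appearance st (num s 0))].
Proof.
move=> le_tT; rewrite /star_appearance.
case El: (active_list st (num s 0)) => [|[v w] [|[v' w'] l]] /=.
- exists 4 => //; eexists; do 4![rewrite /= ?le_tT ?El]; split; reflexivity.
- exists 9 => //; eexists; do 9![rewrite /= ?le_tT ?El]; split; reflexivity.
have [vv'|vv'] := boolP (v == v').
  exists 12 => //; eexists.
  do 12![rewrite /= ?le_tT ?El ?(inj_eq Some_inj) ?vv']; split; reflexivity.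
have [vw'|vw'] := boolP (v == w').
  exists 13 => //; eexists.
  do 13![rewrite /= ?le_tT ?El ?(inj_eq Some_inj) ?(negPf vv') ?vw'];
    split; reflexivity.
exists 13 => //; eexists.
do 13![rewrite /= ?le_tT ?El ?(inj_eq Some_inj) ?(negPf vv')
                  ?(negPf vw')]; split; reflexivity.
Qed.

Lemma star_sc_iterations (n : nat) :
  n <= lifetime G ->
  exists2 k, k <= 13 * n + 3 & exists s : state V,
    [/\ iter k (step st) (star_sc, init_state V) = (loop, s),
        num s 0 = n.+1, num s 1 = lifetime G & out s = star_output st n].
Proof.
(* The 3 steps are the initialisation before the loop. *)
elim: n => [_|n IHn lt_nT]; first by exists 3 => //; eexists; split.
have [k le_k [s [run_k s0 s1 out_s]]] := IHn (ltnW lt_nT).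
have [|j le_j [s' [run_j s'0 s'1 out_s']]] := star_sc_iteration s.
  by rewrite s0 s1.
exists (j + k)%N; first by lia.
exists s'; split; rewrite ?iterD ?run_k ?s'0 ?s'1 ?s0 //.
rewrite out_s' s0 out_s /star_output -(addn1 n) iotaD rev_cat /= add1n.
by rewrite addn1; case: (star_appearance _ _).
Qed.

Lemma star_sc_outputs :
  exists2 n, n <= 13 * lifetime G + 4 &
    outputs_in st star_sc n [fset a in star_output st (lifetime G)].
Proof.
have [k le_k [s [run_k s0 s1 out_s]]] := star_sc_iterations _ (leqnn _).
(* The extra step is the last, failing evaluation of the loop guard. *)
exists k.+1; first by lia.
exists s; rewrite iterS run_k /= s0 s1 ltnn; split=> //.
by rewrite out_s.
Qed.

End Execution.

Section Correctness.
Variables (V : finType) (G : temporalGraph V) (st : storage G).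

(** Turns the size of the output into a count of distinct active times. *)
Lemma star_output_times (n : nat) :
  [seq a.2 | a <- star_output st n] =
  [seq t <- rev (iota 1 n) | active_list st t != [::]].
Proof.
rewrite /star_output; elim: (rev _) => //= t s IHs; rewrite /star_appearance.
by case: (active_list st t) => [|p [|q l]] //=; rewrite IHs.
Qed.

Lemma mem_star_output (n t : nat) (c : V) :
  ((c, t) \in star_output st n) =
  (1 <= t <= n) && (star_center (active_list st t) == Some c).
Proof.
rewrite mem_pmap; apply/mapP/andP => [[t']|[t_n /eqP Ec]].
  rewrite mem_rev mem_iota add1n ltnS /star_appearance => t'_n.
  by case Ec: (star_center _) => [c'|] //= [-> ->]; rewrite t'_n Ec.
exists t; first by rewrite mem_rev mem_iota add1n ltnS.
by rewrite /star_appearance Ec.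
Qed.

Lemma mem_active_list (t : nat) (e : {set V}) :
  1 <= t <= lifetime G ->
  (e \in [seq edge_of p | p <- active_list st t]) = (e \in snapshot G t).
Proof. by move=> t_T; rewrite (perm_mem (active_listP st t_T)) mem_enum. Qed.

(** Either endpoint serves for a single edge. Two distinct edges of a star meet only in its center,
    so an endpoint of the first that lies on the second is the center. *)
Lemma star_center_in (t : nat) (e : {set V}) :
  always_star G -> 1 <= t <= lifetime G -> e \in snapshot G t ->
  exists2 c, star_center (active_list st t) = Some c & c \in e.
Proof.
move=> star t_T e_t.
have [c0 c0P] : exists c, forall f, f \in snapshot G t -> c \in f.
  case/orP: (star t t_T) => [/eqP t0|/existsP[c /forall_inP cP]].
    by rewrite t0 inE in e_t.
  by exists c.
have card2 f : f \in snapshot G t -> #|f| = 2.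
  by rewrite inE => /andP[/edges_card2].
move: (mem_active_list t) (active_listP st t_T) e_t.
case: (active_list st t) => [|[v w] [|[v' w'] l]] /= memE /perm_uniq;
  rewrite enum_uniq -memE // !inE.
  by move=> _ /eqP->; exists v; rewrite // !inE eqxx.
rewrite cons_uniq in_cons negb_or => /andP[/andP[neq _] _] e_l; eexists; first by [].
have vw_t : edge_of (v, w) \in snapshot G t by rewrite -memE // inE eqxx.
have vw'_t : edge_of (v', w') \in snapshot G t by rewrite -memE // !inE eqxx orbT.
have e_t : e \in snapshot G t by rewrite -memE // !inE.
suff -> : (if (v == v') || (v == w') then v else w) = c0 by apply: c0P.
move: (c0P _ vw_t) (c0P _ vw'_t) (card2 _ vw_t) (card2 _ vw'_t) neq.
rewrite /edge_of /= !inE !cards2.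
(* If the shared endpoint were not [c0], both edges would consist of it and [c0], against [neq]. *)
have [->|] := eqVneq v v'.
  case: (eqVneq c0 v') => //= _ /eqP-> /eqP->; by rewrite eqxx.
have [-> _|] := eqVneq v w'.
  case: (eqVneq c0 w') => //= _ /eqP->; rewrite orbF => /eqP->.
  by rewrite setUC eqxx.
by move=> nvw' nvv' /orP[]/eqP-> //; rewrite (negPf nvw') (negPf nvv').
Qed.

(** The output covers each edge at every time it is active, so any active time inside the window
    will do. *)
Lemma star_output_sliding_tvc (Delta : nat) :
  always_star G ->
  sliding_tvc G Delta [fset a in star_output st (lifetime G)].
Proof.
move=> star; split=> [[c t]|t t_T e].
  by rewrite !inE mem_star_output => /andP[].
rewrite inE => /andP[e_G /hasP[t' t'_win /= e_t']].
have t'_T := label_bound e_G e_t'.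
have [|c Ec c_e] := star_center_in t' e star t'_T; first by rewrite inE e_G.
exists (c, t'); split=> //; first by rewrite !inE mem_star_output t'_T Ec eqxx.
by rewrite /temporally_covers c_e.
Qed.

Lemma active_time_near_tvc (Delta t : nat) (M : {fset V * nat}) (e : {set V}) :
  0 < Delta <= lifetime G -> sliding_tvc G Delta M ->
  1 <= t <= lifetime G -> e \in snapshot G t ->
  exists2 a, a \in M & t \in iota (a.2 - Delta.-1) (2 * Delta - 1).
Proof.
move=> Delta_T [_ cover] t_T; rewrite inE => /andP[e_G e_t].
(* The window starting at [t] may overrun the lifetime; the last admissible window then still
   contains [t]. *)
pose t0 := minn t (lifetime G - Delta + 1).
have [||a [a_M a_win _]] := cover t0 _ e; first by lia.
  by rewrite inE e_G; apply/hasP; exists t => //; rewrite mem_iota; lia.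
by exists a => //; move: a_win; rewrite !mem_iota; lia.
Qed.

Lemma size_star_output (Delta : nat) (M : {fset V * nat}) :
  0 < Delta <= lifetime G -> sliding_tvc G Delta M ->
  size (star_output st (lifetime G)) <= (2 * Delta - 1) * #|` M|.
Proof.
move=> Delta_T tvc_M; rewrite -(size_map snd) star_output_times.
(* The times at distance less than [Delta] from [a.2]; truncation of the subtraction at 0 only
   extends the interval to the right. *)
pose near (a : V * nat) := iota (a.2 - Delta.-1) (2 * Delta - 1).
have -> : (2 * Delta - 1) * #|` M| = size (flatten [seq near a | a <- M]).
  rewrite size_flatten sumnE !big_map (eq_bigr (fun=> 2 * Delta - 1)).
    by rewrite big_const_seq count_predT iter_addn_0.
  by move=> a _; rewrite size_iota.
apply: uniq_leq_size; first by rewrite filter_uniq // rev_uniq iota_uniq.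
move=> t; rewrite mem_filter mem_rev mem_iota add1n ltnS => /andP[act t_T].
have [e e_t] : exists e, e \in snapshot G t.
  case: (active_list st t) act (mem_active_list t) => // p l _ /(_ _ t_T) memE.
  by exists (edge_of p); rewrite -memE inE eqxx.
have [a a_M near_a] := active_time_near_tvc Delta t M e Delta_T tvc_M t_T e_t.
by apply/flatten_mapP; exists a.
Qed.

End Correctness.

Theorem theorem1 :
  exists C : nat,
  forall (V : finType) (G : temporalGraph V) (st : storage G) (Delta : nat),
    always_star G -> 2 <= Delta -> Delta <= lifetime G ->
    exists (n : nat) (S : {fset V * nat}),
      [/\ outputs_in st star_sc n S,
          n <= C * lifetime G,
          sliding_tvc G Delta S
        & forall M : {fset V * nat}, minimum_sliding_tvc G Delta M ->
            #|` S| <= (2 * Delta - 1) * #|` M|].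
Proof.
(* 17 = 13 + 4: the additive 4 is absorbed since the lifetime is positive. *)
exists 17 => V G st Delta star Delta2 Delta_T.
have [n le_n out_n] := star_sc_outputs V G st.
exists n, [fset a in star_output st (lifetime G)]; split=> //.
- by lia.
- exact: star_output_sliding_tvc.
move=> M [tvc_M _]; rewrite card_fseq.
apply: leq_trans (size_undup _) _.
by apply: size_star_output => //; rewrite Delta_T andbT; lia.
Qed.
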